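(* Let $\mathcal{C}$ be a class of groups which is closed under taking subgroups and closed under taking finite direct products. Assume that every free-by-$\mathcal{C}$ group is residually $\mathcal{C}$. Then every graph product of residually $\mathcal{C}$ groups is residually $\mathcal{C}$. That is, for every simplicial graph $\Gamma=(V,E)$ (with $V$ of arbitrary cardinality) and every family $\mathcal{G}=\{G_v\mid v\in V\}$ of residually $\mathcal{C}$ groups, the graph product $\Gamma\mathcal{G}$ is residually $\mathcal{C}$.
   Context: A group $G$ is residually $\mathcal{C}$ if for every non-trivial $g\in G$ there exist $C\in\mathcal{C}$ and a surjective homomorphism $\varphi\colon G\twoheadrightarrow C$ with $\varphi(g)\neq e$. A group $G$ is free-by-$\mathcal{C}$ if it has a normal subgroup $N$ which is a free group and $G/N\in\mathcal{C}$. Given a simplicial graph $\Gamma=(V,E)$ (no loops, no multiple edges) and groups $\{G_v\}_{v\in V}$, the graph product $\Gamma\mathcal{G}$ is the quotient of the free product $\ast_{v\in V}G_v$ by the relations $g_ug_v=g_vg_u$ for all $g_u\in G_u$, $g_v\in G_v$ with $\{u,v\}\in E$. *)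

(* Defs.v *)
From Stdlib Require Import List Relations ClassicalEpsilon
  FunctionalExtensionality PropExtensionality ProofIrrelevance.
Import ListNotations.

Record group : Type := Group {
  carrier :> Type;
  gmul : carrier -> carrier -> carrier;
  gone : carrier;
  ginv : carrier -> carrier;
  gmulA : forall x y z, gmul x (gmul y z) = gmul (gmul x y) z;
  gmul1 : forall x, gmul gone x = x;
  gmulr1 : forall x, gmul x gone = x;
  gmulV : forall x, gmul (ginv x) x = gone;
  gmulrV : forall x, gmul x (ginv x) = gone }.

Arguments gmul {g} _ _.
Arguments gone {g}.
Arguments ginv {g} _.

Definition is_hom (G H : group) (f : G -> H) : Prop :=
  forall x y : G, f (gmul x y) = gmul (f x) (f y).

Definition surjective {A B : Type} (f : A -> B) : Prop :=
  forall y, exists x, f x = y.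

Definition injective {A B : Type} (f : A -> B) : Prop :=
  forall x y, f x = f y -> x = y.

Definition residually (C : group -> Prop) (G : group) : Prop :=
  forall g : G, g <> gone ->
    exists (H : group) (f : G -> H),
      C H /\ is_hom G H f /\ surjective f /\ f g <> gone.

Lemma hom_one (G H : group) (f : G -> H) : is_hom G H f -> f gone = gone.
Proof.
  intro hf.
  assert (E : f gone = gmul (f gone) (f gone)).
  { rewrite <- hf. rewrite gmul1. reflexivity. }
  transitivity (gmul (ginv (f gone)) (gmul (f gone) (f gone))).
  - rewrite gmulA, gmulV, gmul1. reflexivity.
  - rewrite <- E. apply gmulV.
Qed.

Lemma hom_inv (G H : group) (f : G -> H) (hf : is_hom G H f) (x : G) :
  f (ginv x) = ginv (f x).
Proof.
  assert (E : gmul (f (ginv x)) (f x) = gone).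
  { rewrite <- hf, gmulV. apply hom_one; exact hf. }
  rewrite <- (gmulr1 _ (f (ginv x))), <- (gmulrV _ (f x)), gmulA, E, gmul1.
  reflexivity.
Qed.

Lemma inv_one (G : group) : ginv (@gone G) = gone.
Proof. rewrite <- (gmul1 G (ginv gone)). apply gmulrV. Qed.

Lemma sig_eq_irr {A : Type} (P : A -> Prop) (a b : sig P) :
  proj1_sig a = proj1_sig b -> a = b.
Proof.
  destruct a as [a pa], b as [b pb]; simpl; intro e; subst b.
  f_equal; apply proof_irrelevance.
Qed.

Section Kernel.
Local Definition ker_T (G Q : group) (p : G -> Q) := {x : G | p x = gone}.

Local Definition ker_mul (G Q : group) (p : G -> Q) (hp : is_hom G Q p)
  (a b : ker_T G Q p) : ker_T G Q p.
Proof.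
  refine (exist _ (gmul (proj1_sig a) (proj1_sig b)) _).
  rewrite hp, (proj2_sig a), (proj2_sig b). apply gmul1.
Defined.

Local Definition ker_one (G Q : group) (p : G -> Q) (hp : is_hom G Q p)
  : ker_T G Q p := exist _ gone (hom_one G Q p hp).

Local Definition ker_inv (G Q : group) (p : G -> Q) (hp : is_hom G Q p)
  (a : ker_T G Q p) : ker_T G Q p.
Proof.
  refine (exist _ (ginv (proj1_sig a)) _).
  rewrite (hom_inv G Q p hp), (proj2_sig a). apply inv_one.
Defined.
End Kernel.

Definition kernel_group (G Q : group) (p : G -> Q) (hp : is_hom G Q p) : group.
Proof.
  refine (@Group (ker_T G Q p) (ker_mul G Q p hp) (ker_one G Q p hp)
            (ker_inv G Q p hp) _ _ _ _ _);
  intros; apply sig_eq_irr; simpl.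
  - apply gmulA.
  - apply gmul1.
  - apply gmulr1.
  - apply gmulV.
  - apply gmulrV.
Defined.

Definition prod_group (G1 G2 : group) : group.
Proof.
  refine (@Group (G1 * G2)%type
            (fun a b => (gmul (fst a) (fst b), gmul (snd a) (snd b)))
            (gone, gone) (fun a => (ginv (fst a), ginv (snd a))) _ _ _ _ _);
  intros; simpl.
  - rewrite !gmulA; reflexivity.
  - rewrite !gmul1; destruct x; reflexivity.
  - rewrite !gmulr1; destruct x; reflexivity.
  - rewrite !gmulV; reflexivity.
  - rewrite !gmulrV; reflexivity.
Defined.

Definition is_free (F : group) : Prop :=
  exists (X : Type) (b : X -> F),
    forall (H : group) (phi : X -> H),
      (exists f : F -> H, is_hom F H f /\ forall x, f (b x) = phi x) /\
      (forall f1 f2 : F -> H, is_hom F H f1 -> is_hom F H f2 ->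
         (forall x, f1 (b x) = f2 (b x)) -> forall y, f1 y = f2 y).

(** G is free-by-C: some normal subgroup N is free with G/N in C.
    Encoded via the first isomorphism theorem: a surjective homomorphism
    onto a group in C whose kernel is free. *)
Definition free_by (C : group -> Prop) (G : group) : Prop :=
  exists (Q : group) (p : G -> Q) (hp : is_hom G Q p),
    surjective p /\ C Q /\ is_free (kernel_group G Q p hp).

Definition subgroup_closed (C : group -> Prop) : Prop :=
  forall (G H : group) (f : H -> G),
    is_hom H G f -> injective f -> C G -> C H.

(** C closed under finite direct products (binary products; with closure
    under isomorphism this gives all finite products with >= 1 factor). *)
Definition product_closed (C : group -> Prop) : Prop :=
  forall G1 G2 : group, C G1 -> C G2 -> C (prod_group G1 G2).

Definition letter (V : Type) (G : V -> group) := {v : V & carrier (G v)}.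
Definition word (V : Type) (G : V -> group) := list (letter V G).

Inductive gstep (V : Type) (E : V -> V -> Prop) (G : V -> group)
  : word V G -> word V G -> Prop :=
| gs_one : forall (u w : word V G) (v : V),
    gstep V E G (u ++ existT _ v (@gone (G v)) :: w) (u ++ w)
| gs_mul : forall (u w : word V G) (v : V) (g h : G v),
    gstep V E G (u ++ existT _ v g :: existT _ v h :: w)
                (u ++ existT _ v (gmul g h) :: w)
| gs_comm : forall (u w : word V G) (a b : V) (g : G a) (h : G b), E a b ->
    gstep V E G (u ++ existT _ a g :: existT _ b h :: w)
                (u ++ existT _ b h :: existT _ a g :: w).

Definition geq (V : Type) (E : V -> V -> Prop) (G : V -> group) :=
  clos_refl_sym_trans (word V G) (gstep V E G).

Lemma gstep_app_l V E G (p a b : word V G) :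
  gstep V E G a b -> gstep V E G (p ++ a) (p ++ b).
Proof.
  intro s; destruct s; rewrite !app_assoc; constructor; assumption.
Qed.

Lemma gstep_app_r V E G (s a b : word V G) :
  gstep V E G a b -> gstep V E G (a ++ s) (b ++ s).
Proof.
  intro st; destruct st; rewrite <- !app_assoc; simpl; constructor; assumption.
Qed.

Lemma geq_app_l V E G (p a b : word V G) :
  geq V E G a b -> geq V E G (p ++ a) (p ++ b).
Proof.
  induction 1.
  - apply rst_step, gstep_app_l; assumption.
  - apply rst_refl.
  - apply rst_sym; assumption.
  - eapply rst_trans; eassumption.
Qed.

Lemma geq_app_r V E G (s a b : word V G) :
  geq V E G a b -> geq V E G (a ++ s) (b ++ s).
Proof.
  induction 1.
  - apply rst_step, gstep_app_r; assumption.
  - apply rst_refl.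
  - apply rst_sym; assumption.
  - eapply rst_trans; eassumption.
Qed.

Lemma geq_app V E G (a a' b b' : word V G) :
  geq V E G a a' -> geq V E G b b' -> geq V E G (a ++ b) (a' ++ b').
Proof.
  intros h1 h2. eapply rst_trans.
  - apply geq_app_r; exact h1.
  - apply geq_app_l; exact h2.
Qed.

Definition linv V G (x : letter V G) : letter V G :=
  existT _ (projT1 x) (ginv (projT2 x)).

Definition winv V G (w : word V G) : word V G := rev (map (linv V G) w).

Lemma geq_winv_l V E G (a : word V G) : geq V E G (winv V G a ++ a) [].
Proof.
  induction a as [|[v g] a IH]; [apply rst_refl|].
  unfold winv; simpl; fold (winv V G a).
  rewrite <- app_assoc; simpl.
  eapply rst_trans; [apply rst_step, gs_mul|]. simpl.
  rewrite gmulV.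
  eapply rst_trans; [apply rst_step, gs_one|]. exact IH.
Qed.

Lemma geq_winv_r V E G (a : word V G) : geq V E G (a ++ winv V G a) [].
Proof.
  induction a as [|[v g] a IH]; [apply rst_refl|].
  unfold winv; simpl; fold (winv V G a).
  rewrite app_assoc.
  apply (rst_trans _ _ _ ([existT (fun v0 => carrier (G v0)) v g] ++ [] ++ [linv V G (existT _ v g)])).
  - apply (geq_app_l V E G [_]), geq_app_r, IH.
  - simpl.
    eapply rst_trans; [apply rst_step, (gs_mul V E G [] [] v g (ginv g))|].
    rewrite gmulrV.
    apply rst_step, (gs_one V E G [] [] v).
Qed.

Definition gp_T (V : Type) (E : V -> V -> Prop) (G : V -> group) :=
  {P : word V G -> Prop | exists w, P = geq V E G w}.

Definition gp_cls V E G (w : word V G) : gp_T V E G :=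
  exist _ (geq V E G w) (ex_intro _ w eq_refl).

Definition gp_rep V E G (P : gp_T V E G) : word V G :=
  proj1_sig (constructive_indefinite_description _ (proj2_sig P)).

Lemma gp_rep_spec V E G (P : gp_T V E G) : proj1_sig P = geq V E G (gp_rep V E G P).
Proof.
  unfold gp_rep. destruct (constructive_indefinite_description _ _); assumption.
Qed.

Lemma gp_cls_rep V E G (P : gp_T V E G) : gp_cls V E G (gp_rep V E G P) = P.
Proof. apply sig_eq_irr; simpl; symmetry; apply gp_rep_spec. Qed.

Lemma gp_cls_eq V E G (a b : word V G) :
  geq V E G a b -> gp_cls V E G a = gp_cls V E G b.
Proof.
  intro h; apply sig_eq_irr; simpl.
  apply functional_extensionality; intro x; apply propositional_extensionality.
  split; intro h'.
  - eapply rst_trans; [apply rst_sym; exact h| exact h'].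
  - eapply rst_trans; [exact h| exact h'].
Qed.

Lemma gp_geq_rep V E G (a : word V G) : geq V E G a (gp_rep V E G (gp_cls V E G a)).
Proof.
  pose proof (gp_rep_spec V E G (gp_cls V E G a)) as H; simpl in H.
  rewrite H; apply rst_refl.
Qed.

Definition gp_mul V E G (P Q : gp_T V E G) : gp_T V E G :=
  gp_cls V E G (gp_rep V E G P ++ gp_rep V E G Q).
Definition gp_one V E G : gp_T V E G := gp_cls V E G [].
Definition gp_inv V E G (P : gp_T V E G) : gp_T V E G :=
  gp_cls V E G (winv V G (gp_rep V E G P)).

Lemma gp_mul_cls V E G (a b : word V G) :
  gp_mul V E G (gp_cls V E G a) (gp_cls V E G b) = gp_cls V E G (a ++ b).
Proof.
  apply gp_cls_eq, geq_app; apply rst_sym, gp_geq_rep.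
Qed.

Lemma gp_inv_cls V E G (a : word V G) :
  gp_inv V E G (gp_cls V E G a) = gp_cls V E G (winv V G a).
Proof.
  unfold gp_inv. apply gp_cls_eq.
  set (b := gp_rep V E G (gp_cls V E G a)).
  assert (hab : geq V E G a b) by apply gp_geq_rep.
  (* winv b ~ winv b ++ (a ++ winv a) ~ (winv b ++ b) ++ winv a ~ winv a *)
  eapply rst_trans.
  { rewrite <- (app_nil_r (winv V G b)) at 1.
    apply geq_app_l, rst_sym, (geq_winv_r V E G a). }
  eapply rst_trans.
  { rewrite app_assoc. apply geq_app_r, geq_app_l, hab. }
  apply (geq_app_r V E G (winv V G a) _ []), geq_winv_l.
Qed.

Definition graph_product (V : Type) (E : V -> V -> Prop) (G : V -> group) : group.
Proof.
  refine (@Group (gp_T V E G) (gp_mul V E G) (gp_one V E G) (gp_inv V E G) _ _ _ _ _).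
  - intros x y z; rewrite <- (gp_cls_rep V E G x), <- (gp_cls_rep V E G y),
      <- (gp_cls_rep V E G z), !gp_mul_cls, app_assoc; reflexivity.
  - intros x; rewrite <- (gp_cls_rep V E G x); unfold gp_one;
      rewrite gp_mul_cls; reflexivity.
  - intros x; rewrite <- (gp_cls_rep V E G x); unfold gp_one;
      rewrite gp_mul_cls, app_nil_r; reflexivity.
  - intros x; rewrite <- (gp_cls_rep V E G x), gp_inv_cls, gp_mul_cls.
    apply gp_cls_eq, geq_winv_l.
  - intros x; rewrite <- (gp_cls_rep V E G x), gp_inv_cls, gp_mul_cls.
    apply gp_cls_eq, geq_winv_r.
Defined.

(* Main.v *)
From Stdlib Require Import List Relations ClassicalEpsilon.
Require Import Defs.
Import ListNotations.

(** Only finitely many vertices occur in a given element x of the graph product,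
    and we induct on that finite set of vertices.  Fix one of them, v, let rho be
    the retraction onto the graph product B of the link of v, and write
      x = a_0 h_1 a_1 ... h_n a_n
    with all h_i non-trivial in G_v, all a_i free of v, and a_i outside B, i.e.
    rho a_i <> a_i, for 0 < i < n.  If n = 0, the induction hypothesis applies.
    Otherwise it yields a homomorphism q to a group Q in C which separates each
    such a_i from rho a_i, and we choose eta : G_v -> H in C which kills no h_i.
    Then K = (Q x Q) x H acts on S = Q x H by (u, w, k) (s, t) = (u s w^-1, k t),
    and there is a homomorphism from the graph product to the semidirect product
    F(S) : K given by
      a |-> (1, (q a, q (rho a), 1))                    off v,
      h |-> ((1, 1)^-1 (1, eta h), (1, 1, eta h))       at v,
    because the image of B fixes the points (1, t) of S.  The F(S)-component
    of the image of x is a non-empty reduced word, so x survives in the group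
    F(S) : K, which is free-by-C. *)

Local Notation "x ** y" := (gmul x y) (at level 40, left associativity).

(** * Elementary group identities *)

Lemma ginv_r_cancel (G : group) (x y : G) : x ** ginv y = gone -> x = y.
Proof.
  intro h.
  rewrite <- (gmulr1 _ x), <- (gmulV _ y), gmulA, h. apply gmul1.
Qed.

Lemma ginv_l_unique (G : group) (x y : G) : x ** y = gone -> x = ginv y.
Proof.
  intro h.
  rewrite <- (gmulr1 _ x), <- (gmulrV _ y), gmulA, h. apply gmul1.
Qed.

Lemma ginv_mul (G : group) (x y : G) : ginv (x ** y) = ginv y ** ginv x.
Proof.
  symmetry; apply ginv_l_unique.
  rewrite gmulA, <- (gmulA _ (ginv y)), gmulV, gmulr1. apply gmulV.
Qed.

Lemma is_hom_comp (G H K : group) (f : G -> H) (g : H -> K) :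
  is_hom G H f -> is_hom H K g -> is_hom G K (fun x => g (f x)).
Proof. intros hf hg x y. rewrite hf. apply hg. Qed.

(** * Separation by homomorphisms *)

(** Unlike in [residually], [f] need not be onto, so such homomorphisms can be paired into direct
    products. *)
Definition separated (C : group -> Prop) (G : group) (x : G) : Prop :=
  exists (H : group) (f : G -> H), C H /\ is_hom G H f /\ f x <> gone.

Section Image.
Variables (G H : group) (f : G -> H) (hf : is_hom G H f).

Let in_image (y : H) : Prop := exists x, f x = y.

Definition image_group : group.
Proof.
  refine (@Group (sig in_image)
    (fun a b => exist in_image (proj1_sig a ** proj1_sig b) _)
    (exist in_image gone _)
    (fun a => exist in_image (ginv (proj1_sig a)) _) _ _ _ _ _).
  Unshelve.
  6: { destruct a as [a [x hx]], b as [b [y hy]]; exists (x ** y); simpl.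
       now rewrite hf, hx, hy. }
  6: { exists gone; now apply hom_one. }
  6: { destruct a as [a [x hx]]; exists (ginv x); simpl.
       now rewrite (hom_inv G H f hf), hx. }
  all: intros; apply sig_eq_irr; simpl.
  - apply gmulA.
  - apply gmul1.
  - apply gmulr1.
  - apply gmulV.
  - apply gmulrV.
Defined.

Definition to_image (x : G) : image_group :=
  exist in_image (f x) (ex_intro _ x eq_refl).
End Image.

(** Restricting the codomain to the image makes a homomorphism onto, and the image embeds in [H], so
    it stays in [C]. *)
Lemma residually_of_separated (C : group -> Prop) (G : group) :
  subgroup_closed C -> (forall x : G, x <> gone -> separated C G x) ->
  residually C G.
Proof.
  intros hsub hsep x hx.
  destruct (hsep x hx) as (H & f & hC & hf & hfx).
  exists (image_group G H f hf), (to_image G H f hf).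
  split; [|split; [|split]].
  - apply (hsub H _ (fun y : image_group G H f hf => proj1_sig y)); trivial.
    + intros a b; reflexivity.
    + intros a b; apply sig_eq_irr.
  - intros a b; apply sig_eq_irr; apply hf.
  - intros [y [a ha]]; exists a; apply sig_eq_irr; exact ha.
  - intro e; apply hfx; exact (f_equal (fun y => proj1_sig y) e).
Qed.

(** Pair the homomorphisms into a direct product; the empty list still needs some member of [C] as
    target. *)
Lemma separated_list (C : group -> Prop) (G : group) :
  product_closed C -> (exists H, C H) ->
  forall xs : list G, (forall x, In x xs -> separated C G x) ->
  exists (H : group) (f : G -> H),
    C H /\ is_hom G H f /\ forall x, In x xs -> f x <> gone.
Proof.
  intros hprod [H0 hH0] xs; induction xs as [|x xs IH]; intro hs.
  - exists H0, (fun _ => gone); split; [|split]; trivial.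
    + intros a b; symmetry; apply gmul1.
    + intros a [].
  - destruct IH as (H & f & hC & hf & hfx).
    { intros; apply hs; now right. }
    destruct (hs x (or_introl eq_refl)) as (H' & f' & hC' & hf' & hfx').
    exists (prod_group H' H), (fun a => (f' a, f a)); split; [|split].
    + now apply hprod.
    + intros a b; simpl; now rewrite hf, hf'.
    + intros a [<- | ha] e; injection e; intros e1 e2.
      * now apply hfx'.
      * now apply (hfx a).
Qed.

(** * Free groups as reduced words *)

Section FreeGroup.
Variable S : Type.

(** In a letter [(s, b)], [true] marks the generator [s] and [false] its inverse. *)
Definition flip (x : S * bool) : S * bool := (fst x, negb (snd x)).

Lemma flipK x : flip (flip x) = x.
Proof. destruct x as [s []]; reflexivity. Qed.

Definition no_cancel (x : S * bool) (w : list (S * bool)) : Prop :=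
  match w with [] => True | y :: _ => y <> flip x end.

Fixpoint reduced (w : list (S * bool)) : Prop :=
  match w with [] => True | x :: w' => no_cancel x w' /\ reduced w' end.

Definition push (x : S * bool) (w : list (S * bool)) : list (S * bool) :=
  match w with
  | [] => [x]
  | y :: w' => if excluded_middle_informative (y = flip x) then w' else x :: w
  end.

Lemma push_no_cancel x w : no_cancel x w -> push x w = x :: w.
Proof.
  destruct w as [|y w]; simpl; trivial; intro h.
  now destruct (excluded_middle_informative (y = flip x)).
Qed.

Lemma push_flip_cons x w : push x (flip x :: w) = w.
Proof.
  simpl; now destruct (excluded_middle_informative (flip x = flip x)).
Qed.

Lemma reduced_push x w : reduced w -> reduced (push x w).
Proof.
  destruct w as [|y w]; simpl; trivial.
  - tauto.
  - intro h; destruct (excluded_middle_informative (y = flip x)); simpl; tauto.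
Qed.

(** This makes [push x] a permutation of the reduced words with inverse [push (flip x)];
    associativity and the inverse laws rest on it. *)
Lemma push_flipK x w : reduced w -> push (flip x) (push x w) = w.
Proof.
  assert (K : forall w, push (flip x) (x :: w) = w).
  { intro u; pose proof (push_flip_cons (flip x) u) as h.
    now rewrite flipK in h. }
  destruct w as [|y w].
  - intros _; apply K.
  - intro h; simpl (push x _).
    destruct (excluded_middle_informative (y = flip x)) as [-> | n].
    + apply push_no_cancel, h.
    + apply K.
Qed.

Lemma push_Kflip x w : reduced w -> push x (push (flip x) w) = w.
Proof. intro h; rewrite <- (flipK x) at 1; now apply push_flipK. Qed.

Definition fmul (u w : list (S * bool)) := fold_right push w u.

Lemma reduced_fmul u w : reduced w -> reduced (fmul u w).
Proof. intro h; induction u; simpl; trivial; now apply reduced_push. Qed.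

Lemma fmul_push x u w :
  reduced w -> fmul (push x u) w = push x (fmul u w).
Proof.
  intro h; destruct u as [|y u]; simpl; trivial.
  destruct (excluded_middle_informative (y = flip x)) as [-> | n]; trivial.
  symmetry; now apply push_Kflip, reduced_fmul.
Qed.

Lemma fmulA u v w :
  reduced w -> fmul u (fmul v w) = fmul (fmul u v) w.
Proof.
  intro h; induction u as [|x u IH]; simpl; trivial.
  now rewrite fmul_push, IH.
Qed.

Lemma fmul_nil u : reduced u -> fmul u [] = u.
Proof.
  induction u as [|x u IH]; simpl; trivial; intros [h1 h2].
  rewrite IH by trivial; now apply push_no_cancel.
Qed.

Definition flip_rev (u : list (S * bool)) := rev (map flip u).

Lemma fmul_flip_rev_l u w : reduced w -> fmul (flip_rev u) (fmul u w) = w.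
Proof.
  intro h; unfold flip_rev, fmul; induction u as [|x u IH]; simpl; trivial.
  rewrite fold_right_app; simpl; rewrite push_flipK; trivial.
  now apply (reduced_fmul u).
Qed.

Lemma fmul_flip_rev_r u w : reduced w -> fmul u (fmul (flip_rev u) w) = w.
Proof.
  unfold flip_rev, fmul; revert w; induction u as [|x u IH]; simpl; trivial.
  intros w h.
  rewrite fold_right_app; simpl; rewrite IH; [now apply push_Kflip|].
  now apply reduced_push.
Qed.

Definition free_group : group.
Proof.
  refine (@Group (sig reduced)
    (fun a b => exist reduced (fmul (proj1_sig a) (proj1_sig b))
                  (reduced_fmul _ _ (proj2_sig b)))
    (exist reduced [] I)
    (* Multiplying the inverse word into [[]] makes reducedness an instance of [reduced_fmul]. *)
    (fun a => exist reduced (fmul (flip_rev (proj1_sig a)) [])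
                  (reduced_fmul _ [] I)) _ _ _ _ _).
  - intros x y z; apply sig_eq_irr; apply fmulA, (proj2_sig z).
  - intros x; now apply sig_eq_irr.
  - intros x; apply sig_eq_irr; apply fmul_nil, (proj2_sig x).
  - intros [x hx]; apply sig_eq_irr; simpl.
    rewrite <- fmulA by trivial.
    pose proof (fmul_flip_rev_l x [] I) as e; now rewrite fmul_nil in e.
  - intros [x hx]; apply sig_eq_irr; now apply fmul_flip_rev_r.
Defined.

Definition free_gen (s : S) : free_group := exist reduced [(s, true)] (conj I I).

Section Lift.
Variables (H : group) (phi : S -> H).

Definition letter_val (x : S * bool) : H :=
  if snd x then phi (fst x) else ginv (phi (fst x)).

Definition free_lift (w : list (S * bool)) : H :=
  fold_right (fun x a => letter_val x ** a) gone w.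

Lemma letter_val_flip x : letter_val x ** letter_val (flip x) = gone.
Proof.
  destruct x as [s []]; unfold letter_val; simpl; [apply gmulrV | apply gmulV].
Qed.

Lemma free_lift_push x w : free_lift (push x w) = letter_val x ** free_lift w.
Proof.
  destruct w as [|y w]; simpl; trivial.
  destruct (excluded_middle_informative (y = flip x)) as [-> | n]; trivial.
  rewrite gmulA, letter_val_flip; symmetry; apply gmul1.
Qed.

Lemma free_lift_fmul u w : free_lift (fmul u w) = free_lift u ** free_lift w.
Proof.
  induction u as [|x u IH]; simpl.
  - symmetry; apply gmul1.
  - rewrite free_lift_push, IH; apply gmulA.
Qed.
End Lift.

(** A reduced word is the product of its letters, as [push] cancels nothing there. This gives
    uniqueness in the universal property. *)
Lemma free_hom_lift (H : group) (f : free_group -> H) :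
  is_hom free_group H f ->
  forall w, f w = free_lift H (fun s => f (free_gen s)) (proj1_sig w).
Proof.
  intros hf [w hw]; induction w as [|[s b] w IH]; simpl.
  - rewrite <- (hom_one _ _ f hf); f_equal; now apply sig_eq_irr.
  - destruct hw as [h1 h2].
    assert (E : exist reduced ((s, b) :: w) (conj h1 h2) =
      gmul (g := free_group) (if b then free_gen s else ginv (free_gen s))
        (exist reduced w h2)).
    { apply sig_eq_irr; simpl; symmetry; rewrite <- push_no_cancel by exact h1.
      now destruct b. }
    rewrite E, hf, (IH h2); destruct b; trivial.
    now rewrite (hom_inv _ _ f hf).
Qed.

Lemma free_group_is_free : is_free free_group.
Proof.
  exists S, free_gen; intros H phi; split.
  - exists (fun w => free_lift H phi (proj1_sig w)); split.
    + intros u w; apply free_lift_fmul.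
    + intro s; apply gmulr1.
  - intros f1 f2 h1 h2 e y.
    rewrite (free_hom_lift H f1 h1), (free_hom_lift H f2 h2).
    induction (proj1_sig y) as [|x w IH]; simpl; trivial.
    rewrite IH; unfold letter_val; now rewrite e.
Qed.

(** * Endomorphisms of the free group induced by injections of the basis *)

Definition rename (sigma : S -> S) (w : list (S * bool)) :=
  map (fun x => (sigma (fst x), snd x)) w.

Section Rename.
Variable sigma : S -> S.
Hypothesis sigma_inj : injective sigma.

(** Injectivity of [sigma] prevents renaming from creating a cancellation. *)
Lemma no_cancel_rename s b w :
  no_cancel (s, b) w -> no_cancel (sigma s, b) (rename sigma w).
Proof.
  destruct w as [|[t c] w]; simpl; trivial.
  intros h e; apply h; injection e; intros -> e'.
  now rewrite (sigma_inj _ _ e').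
Qed.

Lemma reduced_rename w : reduced w -> reduced (rename sigma w).
Proof.
  induction w as [|[s b] w IH]; trivial; intros [h1 h2]; split; [|now apply IH].
  now apply no_cancel_rename.
Qed.

Lemma rename_push s b w :
  rename sigma (push (s, b) w) = push (sigma s, b) (rename sigma w).
Proof.
  destruct w as [|y w]; trivial.
  unfold push at 1; destruct (excluded_middle_informative (y = flip (s, b))) as [-> | n].
  - symmetry; apply (push_flip_cons (sigma s, b)).
  - symmetry; now apply (push_no_cancel (sigma s, b)), (no_cancel_rename s b (y :: w)).
Qed.

Lemma rename_fmul u w :
  rename sigma (fmul u w) = fmul (rename sigma u) (rename sigma w).
Proof.
  induction u as [|[s b] u IH]; trivial.
  simpl; rewrite rename_push; now f_equal.
Qed.
End Rename.
End FreeGroup.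

Lemma is_free_iso (F F' : group) (i : F -> F') (j : F' -> F) :
  is_hom F F' i -> is_hom F' F j ->
  (forall x, j (i x) = x) -> (forall y, i (j y) = y) ->
  is_free F -> is_free F'.
Proof.
  intros hi hj ji ij (X & b & hb).
  exists X, (fun x => i (b x)); intros H phi.
  destruct (hb H phi) as [(f & hf & fb) hu]; split.
  - exists (fun y => f (j y)); split.
    + now apply (is_hom_comp F' F H).
    + intro x; now rewrite ji.
  - intros f1 f2 h1 h2 e y.
    rewrite <- (ij y).
    apply (hu (fun x => f1 (i x)) (fun x => f2 (i x))); trivial;
      now apply (is_hom_comp F F' H).
Qed.

(** * Semidirect products of a free group by a group permuting its basis *)

Section Semidirect.
Variables (K : group) (S : Type) (act : K -> S -> S).
Hypothesis act1 : forall s, act gone s = s.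
Hypothesis actM : forall k l s, act (k ** l) s = act k (act l s).

Lemma act_inj k : injective (act k).
Proof.
  intros s t e; rewrite <- (act1 s), <- (act1 t), <- (gmulV _ k), !actM.
  now rewrite e.
Qed.

Definition free_act (k : K) (w : free_group S) : free_group S :=
  exist (reduced S) (rename S (act k) (proj1_sig w))
    (reduced_rename S (act k) (act_inj k) _ (proj2_sig w)).

Lemma free_act1 w : free_act gone w = w.
Proof.
  apply sig_eq_irr; simpl; unfold rename.
  rewrite <- (map_id (proj1_sig w)) at 2; apply map_ext; intros [s b]; simpl.
  now rewrite act1.
Qed.

Lemma free_actM k l w : free_act (k ** l) w = free_act k (free_act l w).
Proof.
  apply sig_eq_irr; simpl; unfold rename; rewrite map_map.
  apply map_ext; intros [s b]; simpl; now rewrite actM.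
Qed.

Lemma free_act_hom k : is_hom (free_group S) (free_group S) (free_act k).
Proof. intros u w; apply sig_eq_irr; apply rename_fmul, act_inj. Qed.

Definition semidirect : group.
Proof.
  refine (@Group (free_group S * K)%type
    (fun a b => (fst a ** free_act (snd a) (fst b), snd a ** snd b))
    (gone, gone)
    (fun a => (free_act (ginv (snd a)) (ginv (fst a)), ginv (snd a))) _ _ _ _ _).
  - intros [u k] [v l] [w m]; unfold fst, snd.
    now rewrite free_act_hom, free_actM, !gmulA.
  - intros [u k]; unfold fst, snd. now rewrite free_act1, !gmul1.
  - intros [u k]; unfold fst, snd.
    now rewrite (hom_one _ _ _ (free_act_hom k)), !gmulr1.
  - intros [u k]; unfold fst, snd.
    now rewrite <- free_act_hom, !gmulV, (hom_one _ _ _ (free_act_hom _)).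
  - intros [u k]; unfold fst, snd.
    now rewrite <- free_actM, !gmulrV, free_act1, gmulrV.
Defined.

Lemma snd_hom : is_hom semidirect K snd.
Proof. intros a b; reflexivity. Qed.

(** The projection to [K] is onto, and its kernel, the pairs [(w, gone)], is a copy of
    [free_group S]. *)
Lemma semidirect_free_by (C : group -> Prop) : C K -> free_by C semidirect.
Proof.
  intro hK; exists K, (fun a : semidirect => snd a), snd_hom; split; [|split]; trivial.
  - intro k; now exists (gone, k).
  - apply (is_free_iso (free_group S) (kernel_group semidirect K _ snd_hom)
      (fun w => exist (fun a : semidirect => snd a = gone) (w, gone) eq_refl)
      (fun a => fst (proj1_sig a))).
    + intros u w; apply sig_eq_irr.
      change ((u ** w, gone) = (u ** free_act gone w, gone ** @gone K)).
      now rewrite free_act1, gmul1.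
    + intros [[u k] hu] [[w l] hw]; simpl in hu, hw; subst k l.
      change (u ** free_act gone w = u ** w); now rewrite free_act1.
    + trivial.
    + intros [[u k] hu]; apply sig_eq_irr; simpl in *; now subst k.
    + apply free_group_is_free.
Qed.
End Semidirect.

(** * Graph products *)

Section GraphProduct.
Variables (V : Type) (E : V -> V -> Prop) (G : V -> group).

Local Notation GP := (graph_product V E G).

Definition vertex_in (v : V) (g : G v) : GP := gp_cls V E G [existT _ v g].

Lemma vertex_in_cls v g w :
  gp_cls V E G (existT _ v g :: w) = vertex_in v g ** (gp_cls V E G w : GP).
Proof. symmetry; apply gp_mul_cls. Qed.

Lemma vertex_in_hom v : is_hom (G v) GP (vertex_in v).
Proof.
  intros g h; unfold vertex_in; simpl; rewrite gp_mul_cls.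
  apply gp_cls_eq, rst_sym, rst_step, (gs_mul V E G [] []).
Qed.

Lemma vertex_in_comm u v g h :
  E u v -> vertex_in u g ** vertex_in v h = vertex_in v h ** vertex_in u g.
Proof.
  intro e; unfold vertex_in; simpl; rewrite !gp_mul_cls.
  now apply gp_cls_eq, rst_step, (gs_comm V E G [] []).
Qed.

(** The subgroup generated by the vertex groups over [P], built by left multiplication to allow
    induction on a product. *)
Inductive spanned (P : V -> Prop) : GP -> Prop :=
| spanned_one : spanned P gone
| spanned_cons v g x : P v -> spanned P x -> spanned P (vertex_in v g ** x).

Lemma spanned_vertex (P : V -> Prop) v g : P v -> spanned P (vertex_in v g).
Proof.
  intro h; rewrite <- gmulr1; apply spanned_cons; trivial; apply spanned_one.
Qed.

Lemma spanned_mul P x y : spanned P x -> spanned P y -> spanned P (x ** y).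
Proof.
  intros hx hy; induction hx as [|v g x hv hx IH].
  - now rewrite gmul1.
  - rewrite <- gmulA; now apply spanned_cons.
Qed.

Lemma spanned_inv P x : spanned P x -> spanned P (ginv x).
Proof.
  induction 1 as [|v g x hv hx IH].
  - rewrite inv_one; apply spanned_one.
  - rewrite ginv_mul; apply spanned_mul; trivial.
    rewrite <- (hom_inv _ _ _ (vertex_in_hom v)); now apply spanned_vertex.
Qed.

Lemma spanned_mono (P Q : V -> Prop) x :
  (forall v, P v -> Q v) -> spanned P x -> spanned Q x.
Proof.
  intros h; induction 1; constructor; auto.
Qed.

(** A representing word mentions finitely many vertices; this reduces arbitrary [V] to induction on
    a list. *)
Lemma spanned_finite x : exists L : list V, spanned (fun v => In v L) x.
Proof.
  rewrite <- (gp_cls_rep V E G x).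
  induction (gp_rep V E G x) as [|[v g] w [L IH]].
  - exists []; apply spanned_one.
  - exists (v :: L); rewrite vertex_in_cls; apply spanned_cons; [now left|].
    apply (spanned_mono (fun u => In u L)); trivial; intros u hu; now right.
Qed.

(** * Universal property of graph products, and retractions *)

Section Lift.
Variables (H : group) (phi : forall v, G v -> H).
Hypothesis phi_hom : forall v, is_hom (G v) H (phi v).
Hypothesis phi_comm : forall u v g h, E u v ->
  phi u g ** phi v h = phi v h ** phi u g.

Let word_val (w : word V G) : H :=
  fold_right (fun x a => phi (projT1 x) (projT2 x) ** a) gone w.

Let word_val_app u w : word_val (u ++ w) = word_val u ** word_val w.
Proof.
  induction u as [|x u IH]; simpl.
  - symmetry; apply gmul1.
  - rewrite IH; apply gmulA.
Qed.

Let word_val_geq u w : geq V E G u w -> word_val u = word_val w.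
Proof.
  induction 1 as [u w s| | |]; try congruence.
  destruct s; rewrite !word_val_app; f_equal; simpl.
  - rewrite (hom_one _ _ _ (phi_hom v)); apply gmul1.
  - now rewrite phi_hom, gmulA.
  - now rewrite !gmulA, phi_comm.
Qed.

Lemma graph_product_lift :
  exists f : GP -> H, is_hom GP H f /\ forall v g, f (vertex_in v g) = phi v g.
Proof.
  exists (fun x => word_val (gp_rep V E G x)); split.
  - intros x y; rewrite <- word_val_app; symmetry.
    apply word_val_geq, gp_geq_rep.
  - intros v g; transitivity (word_val [existT _ v g]).
    + apply word_val_geq, rst_sym, gp_geq_rep.
    + apply gmulr1.
Qed.
End Lift.

(** Kill the vertex groups outside [P]; the commutation relations survive because [gone] is
    central. *)
Lemma retraction (P : V -> Prop) :
  exists rho : GP -> GP, is_hom GP GP rho /\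
    (forall v g, P v -> rho (vertex_in v g) = vertex_in v g) /\
    (forall v g, ~ P v -> rho (vertex_in v g) = gone).
Proof.
  destruct (graph_product_lift GP (fun v g =>
    if excluded_middle_informative (P v) then vertex_in v g else gone))
    as (rho & hrho & e).
  - intros v g h; destruct (excluded_middle_informative (P v)).
    + apply vertex_in_hom.
    + symmetry; apply gmul1.
  - intros u v g h euv; destruct (excluded_middle_informative (P u)),
      (excluded_middle_informative (P v)); rewrite ?gmul1, ?gmulr1; trivial.
    now apply vertex_in_comm.
  - exists rho; split; [|split]; trivial; intros v g h; rewrite e;
      now destruct (excluded_middle_informative (P v)).
Qed.

(** * Normal form relative to a vertex and its link *)

Section Vertex.
Variable v : V.
Hypothesis E_sym : forall u w, E u w -> E w u.
Hypothesis E_irr : forall u, ~ E u u.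

Variable rho : GP -> GP.
Hypothesis rho_hom : is_hom GP GP rho.
Hypothesis rho_link : forall u g, E v u -> rho (vertex_in u g) = vertex_in u g.
Hypothesis rho_off : forall u g, ~ E v u -> rho (vertex_in u g) = gone.

Lemma rho_spanned P x : spanned P x -> spanned P (rho x).
Proof.
  induction 1 as [|u g x hu hx IH].
  - rewrite (hom_one _ _ _ rho_hom); apply spanned_one.
  - rewrite rho_hom; apply spanned_mul; trivial.
    destruct (classic (E v u)) as [e | n].
    + rewrite rho_link by trivial; now apply spanned_vertex.
    + rewrite rho_off by trivial; apply spanned_one.
Qed.

(** [rho x] is a product of elements of vertex groups adjacent to [v]. *)
Lemma rho_comm P h x :
  spanned P x -> vertex_in v h ** rho x = rho x ** vertex_in v h.
Proof.
  induction 1 as [|u g x hu hx IH].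
  - now rewrite (hom_one _ _ _ rho_hom), gmul1, gmulr1.
  - rewrite rho_hom; destruct (classic (E v u)) as [e | n].
    + rewrite rho_link by trivial.
      now rewrite gmulA, vertex_in_comm, <- gmulA, IH, gmulA.
    + now rewrite rho_off, gmul1.
Qed.

Definition syllables (l : list (G v * GP)) : GP :=
  fold_right (fun ha x => vertex_in v (fst ha) ** (snd ha ** x)) gone l.

(** The last [a] is exempt from [rho a <> a], since no factor from [G v] follows with which [h]
    could merge. *)
Fixpoint normal (P : V -> Prop) (l : list (G v * GP)) : Prop :=
  match l with
  | [] => True
  | (h, a) :: l' =>
      h <> gone /\ spanned P a /\ (l' = [] \/ rho a <> a) /\ normal P l'
  end.

(** Multiply on the left by one factor at a time. A factor [g] from [G v] opens a new syllable
    unless [rho a = a] and a syllable [h] follows; then it commutes past [a] and merges with [h]. If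
    [g ** h] vanishes, [a] and [b] join into a leading factor, on which [normal] imposes nothing. *)
Lemma normal_form (P : V -> Prop) x :
  spanned (fun u => u = v \/ P u) x ->
  exists a l, spanned P a /\ normal P l /\ x = a ** syllables l.
Proof.
  induction 1 as [|u g x hu hx (a & l & ha & hl & ex)].
  - exists gone, []; split; [constructor|split; [exact I|]].
    symmetry; apply gmul1.
  - destruct (classic (u = v)) as [-> | nuv]; [|destruct hu as [|hu]; [easy|]].
    + destruct (classic (g = gone)) as [-> | ng].
      { exists a, l; split; [|split]; trivial.
        now rewrite (hom_one _ _ _ (vertex_in_hom v)), gmul1. }
      destruct (classic (l = [] \/ rho a <> a)) as [na | ra].
      { exists gone, ((g, a) :: l); split; [constructor|split].
        - simpl; auto.
        - rewrite gmul1, ex; reflexivity. }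
      destruct l as [|[h b] l]; [tauto|].
      apply not_or_and in ra; destruct ra as [_ ra]; apply NNPP in ra.
      destruct hl as (nh & hb & hbl & hl).
      assert (ey : vertex_in v g ** x =
                   a ** (vertex_in v (g ** h) ** (b ** syllables l))).
      { rewrite ex.
        change (syllables ((h, b) :: l))
          with (vertex_in v h ** (b ** syllables l)).
        rewrite gmulA, <- ra, (rho_comm P g a ha), ra, vertex_in_hom, !gmulA.
        reflexivity. }
      destruct (classic (g ** h = gone)) as [e | n].
      * exists (a ** b), l; split; [now apply spanned_mul|split; trivial].
        now rewrite ey, e, (hom_one _ _ _ (vertex_in_hom v)), gmul1, gmulA.
      * exists a, ((g ** h, b) :: l); split; [|split]; trivial.
        now repeat split.
    + exists (vertex_in u g ** a), l; split; [now apply spanned_cons|split; trivial].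
      now rewrite ex, gmulA.
Qed.

(** * The homomorphism to the semidirect product *)

Section Target.
Variables (Q H : group) (q : GP -> Q) (eta : G v -> H).
Hypothesis q_hom : is_hom GP Q q.
Hypothesis eta_hom : is_hom (G v) H eta.

Let K : group := prod_group (prod_group Q Q) H.
Let S : Type := (Q * H)%type.
(** With left and right factors [q a] and [q (rho a)], the point [gone] of [Q] stays fixed exactly
    when [q a = q (rho a)]. *)
Let act (k : K) (s : S) : S :=
  (fst (fst k) ** fst s ** ginv (snd (fst k)), snd k ** snd s).

Lemma target_act1 s : act gone s = s.
Proof.
  destruct s as [s t]; unfold act; simpl; now rewrite inv_one, gmulr1, !gmul1.
Qed.

Lemma target_actM k l s : act (k ** l) s = act k (act l s).
Proof.
  destruct k as [[a b] c], l as [[a' b'] c'], s as [s t]; unfold act; simpl.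
  now rewrite ginv_mul, !gmulA.
Qed.

Definition target : group := semidirect K S act target_act1 target_actM.

Definition off_val (x : GP) : K := ((q x, q (rho x)), gone).

Lemma off_val_hom : is_hom GP K off_val.
Proof.
  intros x y.
  change (((q (x ** y), q (rho (x ** y))), gone) =
          ((q x ** q y, q (rho x) ** q (rho y)), gone ** @gone H)).
  now rewrite rho_hom, !q_hom, gmul1.
Qed.

Definition off_hom (x : GP) : target := (gone, off_val x).

Lemma off_hom_hom : is_hom GP target off_hom.
Proof.
  intros x y; unfold off_hom; rewrite off_val_hom.
  unfold target; cbn [gmul semidirect fst snd].
  now rewrite (hom_one _ _ _ (free_act_hom K S act _ _ _)), gmul1.
Qed.

Definition base (h : H) : free_group S := free_gen S (gone, h).

(** The conjugate of [(gone, ((gone, gone), eta h))] by [base gone]. *)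
Definition at_hom (h : G v) : target :=
  (ginv (base gone) ** base (eta h), ((gone, gone), eta h)).

Lemma act_base k h :
  fst (fst k) = snd (fst k) ->
  free_act K S act target_act1 target_actM k (base h) = base (snd k ** h).
Proof.
  destruct k as [[a b] c]; simpl; intros <-; apply sig_eq_irr; simpl.
  unfold act; simpl; now rewrite gmulr1, gmulrV.
Qed.

Lemma at_hom_hom : is_hom (G v) target at_hom.
Proof.
  intros g h; unfold at_hom, target; cbn [gmul semidirect fst snd].
  rewrite free_act_hom, (hom_inv _ _ _ (free_act_hom K S act _ _ _)), !act_base
    by reflexivity.
  cbn [snd]; rewrite gmulr1, eta_hom; f_equal.
  - rewrite <- !gmulA; f_equal. rewrite gmulA, gmulrV, gmul1. reflexivity.
  - simpl; now rewrite !gmul1.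
Qed.

(** For [u] in the link, [rho] fixes [vertex_in u g], so both [Q]-components of [off_val] agree and
    all [base] letters are fixed. *)
Lemma at_off_comm u g h :
  E v u -> at_hom h ** off_hom (vertex_in u g) = off_hom (vertex_in u g) ** at_hom h.
Proof.
  intro e; unfold at_hom, off_hom, target; cbn [gmul semidirect fst snd].
  rewrite (hom_one _ _ _ (free_act_hom K S act _ _ _)), gmulr1, gmul1.
  assert (eo : fst (fst (off_val (vertex_in u g))) = snd (fst (off_val (vertex_in u g)))).
  { simpl; now rewrite rho_link. }
  rewrite free_act_hom, (hom_inv _ _ _ (free_act_hom K S act _ _ _)), !act_base
    by exact eo.
  simpl (snd (off_val _)); rewrite !gmul1; f_equal.
  simpl; now rewrite !gmul1, !gmulr1.
Qed.

Lemma to_target :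
  exists f : GP -> target, is_hom GP target f /\
    (forall h, f (vertex_in v h) = at_hom h) /\
    (forall P x, ~ P v -> spanned P x -> f x = off_hom x).
Proof.
  (* For [u = v], [g] is transported into [G v]; proof irrelevance makes the transport trivial at
     [v] itself. *)
  set (phi := fun u (g : G u) =>
    match excluded_middle_informative (u = v) with
    | left e => at_hom (eq_rect u (fun w => G w) g v e)
    | right _ => off_hom (vertex_in u g)
    end).
  assert (phi_v : forall h, phi v h = at_hom h).
  { intro h; unfold phi; destruct (excluded_middle_informative (v = v)) as [e|]; [|easy].
    now rewrite (ProofIrrelevance.proof_irrelevance _ e eq_refl). }
  assert (phi_off : forall u g, u <> v -> phi u g = off_hom (vertex_in u g)).
  { intros u g n; unfold phi; now destruct (excluded_middle_informative (u = v)). }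
  destruct (graph_product_lift target phi) as (f & hf & ef).
  - intro u; destruct (classic (u = v)) as [-> | n]; intros g h.
    + rewrite !phi_v; apply at_hom_hom.
    + rewrite !phi_off, vertex_in_hom by trivial; apply off_hom_hom.
  - intros a b g h e.
    destruct (classic (a = v)) as [-> | na], (classic (b = v)) as [-> | nb].
    + now destruct (E_irr v).
    + rewrite phi_v, phi_off by trivial; now apply at_off_comm.
    + rewrite phi_v, phi_off by trivial; symmetry; apply at_off_comm.
      now apply E_sym.
    + rewrite !phi_off, <- !off_hom_hom by trivial; f_equal.
      now apply vertex_in_comm.
  - exists f; split; [|split]; trivial.
    + intro h; now rewrite ef.
    + intros P x nv; induction 1 as [|u g x hu hx IH].
      * now rewrite (hom_one _ _ _ hf), (hom_one _ _ _ off_hom_hom).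
      * rewrite hf, off_hom_hom, IH, ef, phi_off; trivial.
        intros ->; contradiction.
Qed.

(* The explicit first letter is what keeps the word reduced when a further
   pair of letters is put in front of it. *)
Lemma syllables_value (P : V -> Prop) (f : GP -> target) :
  ~ P v -> is_hom GP target f ->
  (forall h, f (vertex_in v h) = at_hom h) ->
  (forall P x, ~ P v -> spanned P x -> f x = off_hom x) ->
  forall l, normal P l ->
  (forall h a, In (h, a) l -> eta h <> gone) ->
  (forall h a, In (h, a) l -> rho a <> a -> q a <> q (rho a)) ->
  l <> [] ->
  exists w, proj1_sig (fst (f (syllables l))) = ((gone, gone), false) :: w.
Proof.
  intros nv hf f_at f_off l; induction l as [|[h a] l IH]; [easy|].
  intros (nh & ha & hal & hl) heta hq _.
  (* After the two letters contributed by [h] comes the value of the tail, moved by the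
     [K]-component of the value of [h] and [a]. *)
  exists (((gone, eta h), true) ::
    rename S (act (gmul (g := K) ((gone, gone), eta h) (off_val a)))
      (proj1_sig (fst (f (syllables l))))).
  assert (eh : eta h <> gone) by (apply (heta h a); now left).
  change (syllables ((h, a) :: l)) with (vertex_in v h ** (a ** syllables l)).
  rewrite !hf, f_at, (f_off P a nv ha), gmulA.
  unfold at_hom at 1, off_hom at 1, target.
  cbn [gmul semidirect fst snd].
  rewrite (hom_one _ _ _ (free_act_hom K S act _ _ _)), gmulr1.
  set (k := gmul (g := K) ((gone, gone), eta h) (off_val a)).
  set (w := proj1_sig (fst (f (syllables l)))).
  (* An empty tail gives the empty word. Otherwise its first letter moves to the inverse of
     [(q a ** ginv (q (rho a)), eta h)], and cancelling would force [q a = q (rho a)]. *)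
  assert (nc : no_cancel S ((gone, eta h), true) (rename S (act k) w)).
  { destruct hal as [-> | ra].
    - unfold w; change (syllables []) with (@gone GP).
      now rewrite (hom_one _ _ _ hf).
    - destruct l as [|s l'].
      { unfold w; change (syllables []) with (@gone GP).
      now rewrite (hom_one _ _ _ hf). }
      destruct IH as [w' hw']; trivial; try easy.
      + intros; eapply heta; right; eassumption.
      + intros h' a' hi; apply (hq h' a'); now right.
      + unfold w; rewrite hw'; simpl; unfold act; simpl; intro ee.
        injection ee; intros _ e.
        apply (hq h a); [now left|trivial|].
        apply ginv_r_cancel.
        rewrite <- e. now rewrite !gmul1, gmulr1. }
  rewrite <- gmulA.
  change (push S ((gone, gone), false)
    (push S ((gone, eta h), true) (rename S (act k) w)) =
    ((gone, gone), false) :: ((gone, eta h), true) :: rename S (act k) w).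
  rewrite (push_no_cancel S ((gone, eta h), true)) by exact nc.
  (* The two new letters do not cancel because [eta h <> gone]. *)
  apply push_no_cancel; simpl; intro e; injection e; trivial.
Qed.
End Target.

End Vertex.
End GraphProduct.

(** * Induction on the finite set of vertices *)

Lemma separated_of_residually (C : group -> Prop) (G : group) (x : G) :
  residually C G -> x <> gone -> separated C G x.
Proof.
  intros hr hx; destruct (hr x hx) as (H & f & hC & hf & _ & hfx).
  now exists H, f.
Qed.

Lemma spanned_separated (C : group -> Prop)
  (HC_prod : product_closed C)
  (HC_free : forall G : group, free_by C G -> residually C G)
  (V : Type) (E : V -> V -> Prop)
  (E_sym : forall u v, E u v -> E v u) (E_irr : forall v, ~ E v v)
  (G : V -> group) (HG : forall v, residually C (G v)) (L : list V) :
  forall x : graph_product V E G, spanned V E G (fun u => In u L) x ->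
  x <> gone -> separated C (graph_product V E G) x.
Proof.
  induction L as [|v L IH]; intros x hx nx.
  { destruct hx as [|v g x []]; easy. }
  destruct (retraction V E G (E v)) as (rho & rho_hom & rho_link & rho_off).
  (* [L] may contain [v] again, so [v] is excluded explicitly. *)
  pose (P := fun u => u <> v /\ In u L).
  destruct (normal_form V E G v rho rho_hom rho_link rho_off P x)
    as (a0 & l & ha0 & hl & ex).
  { apply (spanned_mono V E G (fun u => In u (v :: L))); trivial.
    intros u [-> | hu]; [now left|].
    destruct (classic (u = v)); [now left | right; now split]. }
  assert (PL : forall y, spanned V E G P y -> spanned V E G (fun u => In u L) y).
  { intros y; apply spanned_mono; now intros u []. }
  destruct (classic (l = [])) as [-> | nl].
  { change (syllables V E G v []) with (@gone (graph_product V E G)) in ex.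
    rewrite gmulr1 in ex; subst x; apply IH; trivial; now apply PL. }
  assert (hl' : forall h a, In (h, a) l -> h <> gone /\ spanned V E G P a).
  { clear - hl; induction l as [|[h' a'] l IH]; [easy|].
    destruct hl as (n & s & _ & hl); intros h a [e | hi].
    - injection e; intros <- <-; now split.
    - now apply IH. }
  destruct (separated_list C (G v) HC_prod) with (xs := map fst l)
    as (H & eta & hCH & eta_hom & heta).
  (* The first [h] is non-trivial, so residuality of [G v] supplies a member of [C]. *)
  { destruct l as [|[h a] l]; [easy|].
    destruct (HG v h) as (H & _ & hC & _); [apply hl|now exists H]. }
  { intros h hi; apply in_map_iff in hi; destruct hi as [[h' a] [<- hi]].
    apply separated_of_residually; trivial; now apply (hl' h' a). }
  (* Separating [a] from [rho a] means not killing [a ** ginv (rho a)]. The trivial quotients are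
     filtered out; the others are spanned by [P], so the induction hypothesis applies. *)
  destruct (separated_list C (graph_product V E G) HC_prod
      (ex_intro _ H hCH)) with (xs := filter
        (fun y => if excluded_middle_informative (y = gone) then false else true)
        (map (fun ha => snd ha ** ginv (rho (snd ha))) l))
    as (Q & q & hCQ & q_hom & hq).
  { intros y hi; apply filter_In in hi; destruct hi as [hi ny].
    destruct (excluded_middle_informative (y = gone)) as [|ny']; [easy|].
    apply in_map_iff in hi; destruct hi as [[h a] [<- hi]].
    apply IH; trivial; simpl; apply PL.
    destruct (hl' h a hi) as [_ ha].
    apply spanned_mul; trivial; apply spanned_inv.
    now apply (rho_spanned V E G v rho rho_hom rho_link rho_off). }
  destruct (to_target V E G v E_sym E_irr rho rho_hom rho_link Q H q eta q_hom eta_hom)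
    as (f & hf & f_at & f_off).
  assert (nPv : ~ P v) by (intros [n _]; now apply n).
  destruct (syllables_value V E G v rho Q H q eta P f nPv hf f_at f_off l)
    as [w hw]; trivial.
  { intros h a hi; apply heta; apply in_map_iff; now exists (h, a). }
  { intros h a hi ra e.
    apply (hq (a ** ginv (rho a))).
    - apply filter_In; split.
      + apply in_map_iff; now exists (h, a).
      + destruct (excluded_middle_informative (a ** ginv (rho a) = gone)) as [e'|]; trivial.
        apply ginv_r_cancel in e'; now destruct ra.
    - now rewrite q_hom, (hom_inv _ _ _ q_hom), e, gmulrV. }
  destruct (separated_of_residually C (target Q H) (f x)) as (D & g & hD & hg & ng).
  - apply HC_free, semidirect_free_by; repeat apply HC_prod; trivial.
  (* The factor [off_hom a0] only renames letters of the free component, so the word stays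
     non-empty. *)
  - rewrite ex, hf, (f_off P a0 nPv ha0); intro e.
    apply (f_equal (fun t => proj1_sig (fst t))) in e; revert e.
    destruct (f (syllables V E G v l)) as [[u hu] k]; simpl in hw; now subst u.
  - exists D, (fun y => g (f y)); split; [|split]; trivial.
    now apply (is_hom_comp (graph_product V E G) (target Q H) D).
Qed.

Theorem theoremA (C : group -> Prop)
  (HC_sub : subgroup_closed C)
  (HC_prod : product_closed C)
  (HC_free : forall G : group, free_by C G -> residually C G) :
  forall (V : Type) (E : V -> V -> Prop),
    (forall u v, E u v -> E v u) ->
    (forall v, ~ E v v) ->
    forall G : V -> group,
      (forall v, residually C (G v)) ->
      residually C (graph_product V E G).
Proof.
  intros V E E_sym E_irr G HG.
  apply residually_of_separated; trivial; intros x nx.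
  destruct (spanned_finite V E G x) as [L hL].
  now apply (spanned_separated C HC_prod HC_free V E E_sym E_irr G HG L).
Qed.
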